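(* Consider a network of $n$ links with a $C$-independent conflict graph, facing an individual $(T',1-\delta)$-bounded adversary. Suppose an algorithm computes a sequence of actions (one action per phase for each link, phases of $k$ time steps, a phase counting as successful when the link transmits throughout it and at least a $\mu$-fraction of its time steps are successful transmissions) which is $\eta$-blocking and $(\gamma,\epsilon)$-successful with $\epsilon < \frac{1}{4n}\gamma\eta$. Then the average throughput (successful transmissions per time step) of the computed action sequence is an $O\!\left(\frac{C}{\mu\cdot\gamma\cdot\eta}\right)$-approximation of the average optimum.
   Context: A network consists of a set $V$ of $n$ links (sender–receiver pairs); time steps are synchronized and all links share one channel. Interference is modeled by a conflict graph: a weight $b_u(v)\ge 0$ for each ordered pair of links. If a set $L$ of links transmits in a time step, a link $v\in L$ is successful iff the step is not jammed for $v$ and $\sum_{u\in L} b_u(v)\le 1$. A set of links is feasible if all of them can transmit successfully simultaneously. The conflict graph is $C$-independent if for every feasible set $L$ there is $L'\subseteq L$ with $|L'|=\Omega(|L|)$ and $\sum_{v\in L'} b_u(v)\le C$ for all $u\in V$. An adversary may jam time steps; every attempted transmission in a step jammed for a link fails. A (global) $(T',1-\delta)$-bounded adversary jams at most a $(1-\delta)$-fraction of the time steps in any window of $T'$ or more consecutive steps; an individual adversary decides jamming separately for each link, subject to the same restriction for each link. Links observe only success or failure of their own transmissions. For each link, time is partitioned into phases of $k$ consecutive steps (phases of different links need not be aligned); in each phase a link either transmits in every step or in none. A phase of link $v$ is successful if $v$ transmits throughout it and at least a $\mu\in(0,1]$ fraction of its steps are successful. $q_v$ denotes the fraction of $v$'s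 phases in which $v$ transmits, $w_v$ the fraction of $v$'s phases that are successful, and $f_v$ the fraction of $v$'s phases that are unsuccessful due to interference from other links (counted regardless of whether $v$ transmits). The sequence is $(\gamma,\epsilon)$-successful if $\frac{1}{\gamma}(2w_v+\epsilon)\ge q_v$ for all links $v$. It is $\eta$-blocking if every link $v$ with $q_v\le\frac14\eta$ satisfies $f_v\ge\frac14\eta$ and $\sum_{u\in V} b_u(v)q_u\ge\frac18\eta$. The optimum in a time step is a maximum-cardinality set of links that are not jammed in that step and can transmit successfully simultaneously (chosen with full knowledge of the jammer); the average optimum is its average size over time steps. An approximation factor $\rho$ means the average optimum is at most $\rho$ times the average number of successful transmissions per time step of the computed sequence.
   Formalization: The bound on ε is tightened to ε ≤ θγη/(4n) if all links' phases are aligned and ε ≤ θγη/(8n) otherwise, for a fixed θ<1 on which the O-constant depends (as stated the claim fails); C is assumed bounded below by a fixed positive constant. *)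

(* Defs.v *)
From mathcomp Require Import all_boot all_order all_algebra.

Set Implicit Arguments.
Unset Strict Implicit.
Unset Printing Implicit Defensive.

Import Order.TTheory GRing.Theory Num.Theory.
Local Open Scope ring_scope.

(* Each link plays [nphases] consecutive phases of [plen] steps, the i-th phase
   of v being [offset v + i * plen, offset v + i.+1 * plen).  A partition of
   time into blocks of length plen is determined by its offset modulo plen.  A
   link is silent outside its own phases. *)
Record schedule (V : finType) := Schedule {
  plen : nat;
  nphases : nat;
  offset : V -> nat;
  transmits : V -> 'I_nphases -> bool;
  plen_gt0 : (0 < plen)%N;
  nphases_gt0 : (0 < nphases)%N;
  offset_lt : forall v, (offset v < plen)%N
}.

Section Model.
Variables (R : realFieldType) (V : finType).

(* [b u v] is the weight b_u(v), the interference caused by u at v;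
   [jam v t] means that step t is jammed for v (individual adversary). *)
Variables (b : V -> V -> R) (jam : V -> nat -> bool).

Definition succeeds (L : {set V}) (v : V) (t : nat) : bool :=
  ~~ jam v t && (\sum_(u in L) b u v <= 1).

Definition feasible (L : {set V}) : bool :=
  [forall v in L, \sum_(u in L) b u v <= 1].

(* [c] is the constant hidden in |L'| = Omega(|L|). *)
Definition independent (c C : R) : Prop :=
  forall L : {set V}, feasible L ->
    exists L' : {set V},
      [/\ L' \subset L, c * #|L|%:R <= #|L'|%:R
        & forall u : V, \sum_(v in L') b u v <= C].

Definition opt (t : nat) : nat :=
  \max_(L : {set V} | [forall v in L, succeeds L v t]) #|L|.

Section Sequence.
Variable s : schedule V.

Definition step (v : V) (i : 'I_(nphases s)) (j : 'I_(plen s)) : nat :=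
  (offset s v + i * plen s + j)%N.

Definition active (t : nat) : {set V} :=
  [set v | [exists i : 'I_(nphases s), exists j : 'I_(plen s),
              (t == step v i j) && transmits v i]].

(* The least time by which all the phases of all the links are over. *)
Definition horizon : nat := (\max_(v : V) offset s v + nphases s * plen s)%N.

Definition avg_opt : R := (\sum_(t < horizon) opt t)%N%:R / horizon%:R.

Definition throughput : R :=
  (\sum_(t < horizon) #|[set v in active t | succeeds (active t) v t]|)%N%:R
    / horizon%:R.

Definition adversary_bounded (T' : nat) (delta : R) : Prop :=
  forall (v : V) (t0 l : nat), (T' <= l)%N -> (t0 + l <= horizon)%N ->
    (\sum_(t0 <= t < t0 + l) jam v t)%N%:R <= (1 - delta) * l%:R.

(* At least a mu-fraction of the steps of phase i of v is successful for v when
   the set of transmitting links at time t is [X t]. *)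
Definition phase_ok (mu : R) (X : nat -> {set V}) (v : V)
    (i : 'I_(nphases s)) : bool :=
  mu * (plen s)%:R
    <= #|[set j : 'I_(plen s) | succeeds (X (step v i j)) v (step v i j)]|%:R.

Definition phase_successful (mu : R) (v : V) (i : 'I_(nphases s)) : bool :=
  transmits v i && phase_ok mu active v i.

(* Failure "due to interference" is read counterfactually, whatever v does in
   the phase: if v transmitted throughout, the phase would be unsuccessful with
   the other links' transmissions and successful without them. *)
Definition phase_interfered (mu : R) (v : V) (i : 'I_(nphases s)) : bool :=
  ~~ phase_ok mu (fun t => v |: active t) v i
  && phase_ok mu (fun=> [set v]) v i.

Definition frac (P : pred 'I_(nphases s)) : R :=
  #|[set i | P i]|%:R / (nphases s)%:R.

Definition q (v : V) : R := frac (fun i => transmits v i).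
Definition w (mu : R) (v : V) : R := frac (phase_successful mu v).
Definition f (mu : R) (v : V) : R := frac (phase_interfered mu v).

Definition successful (mu gamma eps : R) : Prop :=
  forall v : V, gamma^-1 * (2 * w mu v + eps) >= q v.

Definition blocking (mu eta : R) : Prop :=
  forall v : V, q v <= 4^-1 * eta ->
    f mu v >= 4^-1 * eta /\ \sum_(u : V) b u v * q u >= 8^-1 * eta.

End Sequence.
End Model.

(* The largest number of phases of one link that a phase of another can spoil.
   An interfered phase of v meets an active phase of some other link, and each
   active phase is met by at most [overlap] phases of v, so that
   f_v <= overlap * \sum_(u != v) q_u; the admissible error term eps scales with
   the inverse of this number. *)
Definition overlap (V : finType) (s : schedule V) : nat :=
  if [forall u : V, forall v : V, offset s u == offset s v] then 1 else 2.

(* Main.v *)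
Require Import Defs.
From mathcomp Require Import all_boot all_order all_algebra.
From mathcomp Require Import zify lra.

Set Implicit Arguments.
Unset Strict Implicit.
Unset Printing Implicit Defensive.

Import Order.TTheory GRing.Theory Num.Theory.
Local Open Scope ring_scope.

(** Write Q and W for the sums of the q_v and of the w_v.  Split the
    C-independent part of an optimal set of a step according to whether
    q_v <= eta/4.  The links with q_v > eta/4 number at most 4Q/eta; summing the
    second blocking inequality over the others and exchanging the sums, these
    number at most 8CQ/eta.  Hence opt = O(CQ/eta).  Success of the sequence
    gives gamma Q <= 2W + n eps.  The first blocking inequality forces
    Q >= eta / (4 overlap), since an interfered phase meets an active phase of
    another link; so n eps is at most a fraction theta < 1 of gamma Q, and
    Q = O(W / gamma).  Finally each successful phase contributes mu plen
    successful transmissions, and the horizon is at most twice the length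
    nphases * plen of the play of a link, so W = O(throughput / mu). *)

(** * Combinatorics of shifted phases *)

Lemma card_ord_window (n m a : nat) (A : {set 'I_n}) :
  (forall i, i \in A -> a <= i < a + m)%N -> (#|A| <= m)%N.
Proof.
move=> hA; rewrite cardE -(size_map val) -[leqRHS](size_iota a).
apply: uniq_leq_size.
  by rewrite map_inj_uniq ?enum_uniq //; exact: val_inj.
by move=> x /mapP[i]; rewrite mem_enum mem_iota => /hA hi ->.
Qed.

(** Offsets below [k] shift the two grids by less than one period. Phases sharing a step thus have
    indices at most one apart, and the order of the offsets gives the direction. *)
Lemma overlapping_phases (k x y ox oy : nat) :
  (ox < k -> oy < k -> ox + x * k < oy + y.+1 * k -> oy + y * k < ox + x.+1 * k ->
  if ox == oy then x == y else if ox < oy then y <= x <= y.+1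
  else x <= y <= x.+1)%N.
Proof.
move=> hx hy h1 h2.
have lt_k m n : (m * k < n * k)%N -> (m < n)%N by rewrite ltn_mul2r => /andP[].
rewrite !mulSn in h1 h2.
have xy : (x * k < y.+2 * k)%N by rewrite !mulSn; lia.
have yx : (y * k < x.+2 * k)%N by rewrite !mulSn; lia.
have {}xy := lt_k _ _ xy; have {}yx := lt_k _ _ yx.
have hle : (oy <= ox -> x <= y)%N.
  by move=> le; rewrite -ltnS; apply: lt_k; rewrite mulSn; lia.
have hge : (ox <= oy -> y <= x)%N.
  by move=> le; rewrite -ltnS; apply: lt_k; rewrite mulSn; lia.
case: eqVneq => [e|_]; first by rewrite eqn_leq hle ?hge ?e.
case: ltnP => [/ltnW/hge ->|/hle -> //]; lia.
Qed.

Section Schedule.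
Variables (V : finType) (s : schedule V).

Lemma step_inj (v : V) (i i' : 'I_(nphases s)) (j j' : 'I_(plen s)) :
  step v i j = step v i' j' -> (i, j) = (i', j').
Proof.
rewrite /step -!addnA => /addnI e.
have k0 : (0 < plen s)%N := plen_gt0 s.
have ei : i = i'.
  apply: val_inj => /=.
  have := congr1 (fun x => x %/ plen s)%N e.
  by rewrite !divnMDl // !divn_small // !addn0.
by move: e; rewrite ei => /addnI/val_inj ->.
Qed.

Lemma step_lt_horizon (v : V) (i : 'I_(nphases s)) (j : 'I_(plen s)) :
  (step v i j < horizon s)%N.
Proof.
rewrite /step /horizon -addnA -addnS leq_add //.
  exact: (leq_bigmax (F := fun v => offset s v)).
rewrite -addnS (@leq_trans (i.+1 * plen s)) //.
  by rewrite mulSn addnC leq_add2r.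
by rewrite leq_mul2r ltn_ord orbT.
Qed.

Lemma horizon_gt0 : (0 < horizon s)%N.
Proof. by rewrite /horizon addn_gt0 muln_gt0 nphases_gt0 plen_gt0 orbT. Qed.

Lemma horizon_le : (horizon s <= 2 * (nphases s * plen s))%N.
Proof.
rewrite /horizon mul2n -addnn leq_add2r (@leq_trans (plen s)) //.
  by apply/bigmax_leqP => v _; exact: ltnW (offset_lt s v).
by rewrite leq_pmull // nphases_gt0.
Qed.

Definition meets (v : V) (i : 'I_(nphases s)) (u : V) (i' : 'I_(nphases s)) : bool :=
  [exists j : 'I_(plen s), exists j' : 'I_(plen s), step v i j == step u i' j'].

Lemma card_meets (v u : V) (i' : 'I_(nphases s)) :
  (#|[set i | meets v i u i']| <= overlap s)%N.
Proof.
have near i : i \in [set i | meets v i u i'] ->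
    (if offset s v == offset s u then i == i' :> nat
     else if offset s v < offset s u then i' <= i <= i'.+1
     else i <= i' <= i.+1)%N.
  rewrite inE => /existsP[j /existsP[j' /eqP]]; rewrite /step => e.
  have hj : (j < plen s)%N := ltn_ord j; have hj' : (j' < plen s)%N := ltn_ord j'.
  by apply: (@overlapping_phases (plen s)); rewrite ?offset_lt // mulSn; lia.
rewrite /overlap; case: ifP => [/forallP/(_ v)/forallP/(_ u) e | _].
  by apply: (@card_ord_window _ _ i') => i /near; rewrite e; lia.
(* First index of a window of length two: from [i'] on if [v] has the smaller offset, ending at [i']
   otherwise. For [i' = 0] the truncated predecessor is 0, and the window still contains [i']. *)
pose a : nat := if (offset s v < offset s u)%N then nat_of_ord i' else i'.-1.
apply: (@card_ord_window _ _ a) => i /near; rewrite /a.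
by case: eqVneq => _; case: ltnP => _; lia.
Qed.

End Schedule.

(** * Inequalities between rates, optimum and throughput *)

Section Rates.
Variables (R : realFieldType) (V : finType).
Variables (b : V -> V -> R) (jam : V -> nat -> bool) (s : schedule V).

Let Q : R := \sum_v q R s v.

Lemma frac_ge0 (P : pred 'I_(nphases s)) : 0 <= Defs.frac R P.
Proof. by rewrite /frac divr_ge0. Qed.

Lemma q_le_sum (v : V) : q R s v <= Q.
Proof.
by rewrite /Q (bigD1 v) //= lerDl sumr_ge0 // => u _; exact: frac_ge0.
Qed.

(** If no link but [v] were active during the phase, adding [v] to the active set would give
    [[set v]] at each step, and the two halves of [phase_interfered] would contradict each other. *)
Lemma interfered_meets (mu : R) (v : V) (i : 'I_(nphases s)) :
  phase_interfered b jam mu v i ->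
  exists u i', transmits u i' && meets v i u i'.
Proof.
case/andP=> bad good.
have [/forallP quiet|] :=
  boolP [forall j : 'I_(plen s), active s (step v i j) \subset [set v]].
  case/negP: bad; move: good; rewrite /phase_ok.
  suff -> : [set j : 'I_(plen s) |
             succeeds b jam (v |: active s (step v i j)) v (step v i j)]
    = [set j : 'I_(plen s) | succeeds b jam [set v] v (step v i j)] by [].
  by apply/setP => j; rewrite !inE (setUidPl (quiet j)).
rewrite negb_forall => /existsP[j /subsetPn[u]].
rewrite /active inE => /existsP[i' /existsP[j' /andP[e tr]]] _.
by exists u, i'; rewrite tr; apply/existsP; exists j; apply/existsP; exists j'.
Qed.

(** Double counting of the pairs formed by a phase of [v] and an active phase that meets it. *)
Lemma f_le (mu : R) (v : V) : f b jam s mu v <= (overlap s)%:R * Q.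
Proof.
rewrite /Q /f /q /frac -mulr_suml mulrA ler_wpM2r ?invr_ge0 //.
rewrite -natr_sum -natrM ler_nat big_distrr /=.
rewrite -sum1dep_card.
apply: (@leq_trans (\sum_(i : 'I_(nphases s)) \sum_(u : V) \sum_(i' | transmits u i')
                       meets v i u i')).
  rewrite [leqRHS](bigID (phase_interfered b jam mu v)) /=.
  apply: leq_trans (leq_addr _ _).
  apply: leq_sum => i /interfered_meets[u [i' /andP[tr m]]].
  by rewrite (bigD1 u) //= (bigD1 i') //= m.
rewrite exchange_big leq_sum // => u _; rewrite exchange_big /=.
rewrite -sum1dep_card big_distrr leq_sum //= => i' _.
rewrite muln1 -big_mkcond /= sum1dep_card; exact: card_meets.
Qed.

Lemma blocking_sum_q (mu eta : R) :
  (0 < #|V|)%N -> blocking b jam s mu eta -> 0 < eta ->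
  4^-1 * eta <= (overlap s)%:R * Q.
Proof.
move=> /card_gt0P[v _] hb eta0.
have [/hb[hf _]|hq] := leP (q R s v) (4^-1 * eta).
  exact: le_trans hf (f_le _ _).
(* A single rate above the threshold already suffices, as [overlap s] is at least 1. *)
have hQ : 4^-1 * eta <= Q := le_trans (ltW hq) (q_le_sum v).
apply: le_trans hQ _; apply: ler_peMl.
  by rewrite sumr_ge0 // => u _; exact: frac_ge0.
by rewrite ler1n /overlap; case: ifP.
Qed.

Lemma opt_le (c C c0 mu eta : R) (t : nat) :
  0 < c -> 0 < c0 -> c0 <= C -> 0 < eta ->
  (forall u v, 0 <= b u v) -> independent b c C -> blocking b jam s mu eta ->
  (opt b jam t)%:R <= c^-1 * (8 + 4 / c0) * (C / eta) * Q.
Proof.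
move=> c_gt0 c0_gt0 c0C eta0 b0 ind hb.
have Q0 : 0 <= Q by apply: sumr_ge0 => u _; exact: frac_ge0.
have C0 : 0 < C := lt_le_trans c0_gt0 c0C.
(* The bound passes to maxima, so it is enough to treat one set [L] of links that succeed together
   at [t]. *)
rewrite /opt; elim/big_ind: _ => [|m n hm hn|L hL].
- by rewrite mulr_ge0 // mulr_ge0 ?divr_ge0 ?mulr_ge0 ?invr_ge0 ?addr_ge0
    ?divr_ge0 // ltW.
- by case/orP: (leq_total m n) => [/maxn_idPr|/maxn_idPl] ->.
have /ind[L' [_ cL hC]] : feasible b L.
  apply/forall_inP => v vL; have /forall_inP/(_ v vL) := hL.
  by case/andP.
rewrite -!mulrA ler_pdivlMl //; apply: le_trans cL _.
(* Low-rate links: after the exchange of sums, each [q R s u] has a coefficient that independence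
   bounds by [C]. *)
have lo : 8^-1 * eta * (#|[set v in L' | q R s v <= 4^-1 * eta]|)%:R <= C * Q.
  rewrite mulr_natr -sumr_const.
  apply: (@le_trans _ _ (\sum_(v in [set v in L' | q R s v <= 4^-1 * eta])
                            \sum_u b u v * q R s u)).
    by apply: ler_sum => v; rewrite inE => /andP[_ /hb[]].
  rewrite exchange_big mulr_sumr ler_sum // => u _.
  rewrite -mulr_suml ler_wpM2r ?frac_ge0 //; apply: le_trans (hC u).
  rewrite [leRHS](big_setID [set v | q R s v <= 4^-1 * eta]) /= setIdE.
  by rewrite lerDl sumr_ge0.
have hi : 4^-1 * eta * (#|L' :\: [set v | q R s v <= 4^-1 * eta]|)%:R <= Q.
  rewrite mulr_natr -sumr_const.
  apply: (@le_trans _ _ (\sum_(v in L' :\: [set v | q R s v <= 4^-1 * eta]) q R s v)).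
    by apply: ler_sum => v; rewrite !inE -ltNge => /andP[/ltW].
  rewrite /Q [leRHS](bigID (mem (L' :\: [set v | q R s v <= 4^-1 * eta]))) /=.
  by rewrite lerDl sumr_ge0 // => u _; exact: frac_ge0.
rewrite -(cardsID [set v | q R s v <= 4^-1 * eta] L') -setIdE natrD.
have {}lo : (#|[set v in L' | q R s v <= 4^-1 * eta]|)%:R <= 8 * (C * Q / eta).
  rewrite mulrA ler_pdivlMr //; move: lo; lra.
have {}hi : (#|L' :\: [set v | q R s v <= 4^-1 * eta]|)%:R <= 4 * (Q / eta).
  rewrite mulrA ler_pdivlMr //; move: hi; lra.
(* The high-rate term lacks the factor [C]; [c0 <= C] supplies it, which is where [4 / c0] comes
   from. *)
have : Q / eta <= (C / c0) * (Q / eta).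
  by apply: ler_peMl; [rewrite divr_ge0 // ltW|rewrite ler_pdivlMr ?mul1r].
move: lo hi; lra.
Qed.

Lemma sum_w_le (mu : R) :
  0 < mu -> mu * \sum_v w b jam s mu v <= 2 * throughput b jam s.
Proof.
move=> mu0.
pose succ v t := (v \in active s t) && succeeds b jam (active s t) v t.
have k0 : 0 < (plen s)%:R :> R by rewrite ltr0n plen_gt0.
have N0 : 0 < (nphases s)%:R :> R by rewrite ltr0n nphases_gt0.
have H0 : 0 < (horizon s)%:R :> R by rewrite ltr0n horizon_gt0.
have perlink v : mu * (plen s)%:R * ((nphases s)%:R * w b jam s mu v)
    <= (\sum_(t < horizon s) succ v t)%N%:R.
  (* Successful steps of [v], indexed by phase and position. Grouped by phase, they bound the
     successful phases; the injection [g] below sends them to steps before the horizon. *)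
  pose A := [set p : 'I_(nphases s) * 'I_(plen s) | succ v (step v p.1 p.2)].
  have cardA : (#|A| = \sum_(i < nphases s)
                        #|[set j : 'I_(plen s) | succ v (step v i j)]|)%N.
    rewrite -sum1dep_card big_mkcond.
    rewrite -(pair_bigA _ (fun i j => if succ v (step v i j) then 1 else 0)%N) /=.
    by apply: eq_bigr => i _; rewrite -big_mkcond sum1dep_card.
  apply: (@le_trans _ _ #|A|%:R).
    rewrite /w /frac [(nphases s)%:R * _]mulrC divfK ?gt_eqF //.
    rewrite cardA natr_sum -sum1dep_card natr_sum mulr_sumr.
    rewrite [leRHS](bigID (phase_successful b jam mu v)) /=.
    rewrite -[leLHS]addr0 lerD ?sumr_ge0 // ler_sum // => i /andP[tr].
    rewrite mulr1 => /le_trans; apply; rewrite ler_nat subset_leq_card //.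
    apply/subsetP => j; rewrite !inE /succ => ->; rewrite andbT inE.
    by apply/existsP; exists i; apply/existsP; exists j; rewrite eqxx.
  rewrite ler_nat -big_mkcond sum1dep_card.
  pose g (p : 'I_(nphases s) * 'I_(plen s)) := Ordinal (step_lt_horizon v p.1 p.2).
  rewrite -(card_imset A (f := g)); last first.
    by move=> [i j] [i' j'] /(congr1 val)/step_inj.
  by apply/subset_leq_card/subsetP => _ /imsetP[p + ->]; rewrite !inE.
(* Throughput averages over the horizon, rates over the phases; comparing the two lengths costs the
   factor 2. *)
have Hle : (horizon s)%:R <= 2 * ((nphases s)%:R * (plen s)%:R) :> R.
  by rewrite -!natrM ler_nat horizon_le.
have : mu * (plen s)%:R * (nphases s)%:R * (\sum_v w b jam s mu v)
    <= throughput b jam s * (horizon s)%:R.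
  rewrite /throughput divfK ?gt_eqF // -mulrA !mulr_sumr.
  apply: le_trans (ler_sum _ (fun v _ => perlink v)) _.
  rewrite -natr_sum ler_nat exchange_big leq_sum //= => t _.
  by rewrite -sum1dep_card [leqRHS]big_mkcond.
have thr0 : 0 <= throughput b jam s :> R by rewrite divr_ge0.
move=> h; have {}h := le_trans h (ler_wpM2l thr0 Hle).
have NK : 0 < (nphases s)%:R * (plen s)%:R :> R by rewrite mulr_gt0.
rewrite -(ler_pM2r NK); move: h; lra.
Qed.

End Rates.

(** [K] is chosen before the network, so the approximation constant is uniform; [theta < 1]
    quantifies the strict bound on [eps]. *)
Theorem theorem1 (R : realFieldType) (c c0 theta : R)
    (hc : 0 < c) (hc0 : 0 < c0) (htheta : theta < 1) :
  exists2 K : R, 0 < K &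
    forall (V : finType) (b : V -> V -> R) (C : R)
           (jam : V -> nat -> bool) (T' : nat) (delta : R)
           (s : schedule V) (mu gamma eta eps : R),
      (0 < #|V|)%N ->
      (forall u v : V, 0 <= b u v) ->
      c0 <= C ->
      independent b c C ->
      (0 < T')%N -> 0 < delta <= 1 ->
      adversary_bounded jam s T' delta ->
      0 < mu <= 1 -> 0 < gamma -> 0 < eta ->
      blocking b jam s mu eta ->
      successful b jam s mu gamma eps ->
      (overlap s)%:R * eps <= theta * ((4 * #|V|)%N%:R^-1 * gamma * eta) ->
      avg_opt b jam s <= K * (C / (mu * gamma * eta)) * throughput b jam s.
Proof.
(* Clipping at 0 allows multiplying inequalities by [th]. *)
pose th := Num.max theta 0.
have th1 : 0 < 1 - th by rewrite subr_gt0 gt_max htheta ltr01.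
have th0 : 0 <= th by rewrite le_max lexx orbT.
have thge : theta <= th by rewrite le_max lexx.
pose D := c^-1 * (8 + 4 / c0).
have D0 : 0 < D by rewrite mulr_gt0 ?invr_gt0 ?addr_gt0 ?divr_gt0.
(* [D] comes from [opt_le]; 4 is the 2 in [successful] times the 2 of [sum_w_le]; [1 - th] is what
   remains of [gamma * Q] once the error is absorbed. *)
exists (4 * D / (1 - th)).
  by do 2?[apply: mulr_gt0 => //]; rewrite ?invr_gt0 ?ltr0n.
move=> V b C jam T' delta s mu gamma eta eps V0 b0 c0C ind _ _ _ /andP[mu0 _].
move=> gamma0 eta0 hb hs heps.
have C0 : 0 < C := lt_le_trans hc0 c0C.
have n0 : 0 < #|V|%:R :> R by rewrite ltr0n.
set Q := \sum_v q R s v; set W := \sum_v w b jam s mu v.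
have ov0 : 0 < (overlap s)%:R :> R by rewrite ltr0n /overlap; case: ifP.
have hQ : 4^-1 * eta <= (overlap s)%:R * Q by exact: blocking_sum_q hb eta0.
have gQ : gamma * Q <= 2 * W + #|V|%:R * eps.
  rewrite -ler_pdivlMl // /W mulr_sumr mulr_natl -sumr_const -big_split mulr_sumr.
  by apply: ler_sum => v _; exact: hs.
have epsQ : #|V|%:R * eps <= th * (gamma * Q).
  (* Scaled by the overlap, the bound on [eps] matches the lower bound [hQ], and the number of links
     cancels. *)
  rewrite -(ler_pM2l ov0).
  have -> : (overlap s)%:R * (th * (gamma * Q))
    = th * gamma * ((overlap s)%:R * Q) by lra.
  apply: le_trans (ler_wpM2l _ hQ); last by rewrite mulr_ge0 // ltW.
  rewrite mulrCA -ler_pdivlMl //; apply: le_trans heps _.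
  rewrite natrM invfM.
  have : 0 <= #|V|%:R^-1 * gamma * eta by rewrite !mulr_ge0 ?invr_ge0 ?ltW.
  set x := #|V|%:R^-1; nra.
have QT : Q <= 4 / (1 - th) * (throughput b jam s / (mu * gamma)).
  have hW : mu * W <= 2 * throughput b jam s by exact: sum_w_le.
  have hQW : (1 - th) * (gamma * Q) <= 2 * W by lra.
  rewrite [leRHS]mulrACA -invfM ler_pdivlMr ?mulr_gt0 //.
  have := ler_wpM2l (ltW mu0) hQW; lra.
have optQ : avg_opt b jam s <= D * (C / eta) * Q.
  rewrite /avg_opt ler_pdivrMr ?ltr0n ?horizon_gt0 // natr_sum.
  rewrite mulr_natr -[X in _ *+ X]card_ord -sumr_const ler_sum // => t _.
  exact: opt_le hc0 c0C eta0 b0 ind hb.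
apply: le_trans optQ _.
have DC0 : 0 <= D * (C / eta) by rewrite mulr_ge0 ?divr_ge0 ?ltW.
apply: le_trans (ler_wpM2l DC0 QT) _.
rewrite !invfM; lra.
Qed.
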